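(* The minimal exponential $X\mapsto\mathsf{Exp}_\vee(X)$ is an exponential functor on the category of topological spaces.
   Context: For a set $X$, $\mathrm{Exp}(X)$ is the set of finite subsets of $X$ (including the empty one $[\emptyset]$); a map $f:X\to Y$ induces $S\mapsto f(S)$. For a topological space $X$, the minimal exponential $\mathsf{Exp}_\vee(X)$ is the set $\mathrm{Exp}(X)$ with the coarsest topology containing the subsets $\mathrm{Exp}(U)\subset\mathrm{Exp}(X)$ for all open $U\subset X$. The monoidal structure is the one with underlying bijections $\mathrm{Exp}(\emptyset)=\{[\emptyset]\}$ and $\mathrm{Exp}(X)\times\mathrm{Exp}(Y)\cong\mathrm{Exp}(X\sqcup Y)$, $(S,T)\mapsto S\sqcup T$. Finite product of an infinite family: for a small family $\{X_i\}_{i\in I}$ of pointed topological spaces, $\prod^{\mathrm f}_{i\in I}X_i:=\varinjlim_{J\subset I,\ J\text{ finite}}\prod_{j\in J}X_j$, the transition maps being induced by the base points. Exponential functor (on the category $\mathcal C$ of topological spaces): if $E:(\mathcal C,\sqcup)\to(\mathcal C,\times)$ is a (strong) symmetric monoidal functor from $\mathcal C$ with coproducts to $\mathcal C$ with products, each $E(X)$ is pointed by $\ast\cong E(\emptyset)\to E(X)$, and the maps $\prod_{i\in J}E(X_i)\cong E(\coprod_{i\in J}X_i)\to E(\coprod_{i\in I}X_i)$, $J\subset I$ finite, induce a canonical map $\prod^{\mathrm f}_{i\in I}E(X_i)\to E(\coprod_{i\in I}X_i)$. $E$ is an exponential functor if this map is an isomorphism (homeomorphism) for every small family $\{X_i\}_{i\in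 I}$. *)

(* Defs.v *)
From HB Require Import structures.
From mathcomp Require Import all_boot all_order finmap.
From mathcomp Require Import all_classical topology.
From Stdlib Require Import Relation_Operators.

Set Implicit Arguments.
Unset Strict Implicit.
Unset Printing Implicit Defensive.

Local Open Scope classical_set_scope.
Local Open Scope quotient_scope.

(* The category of topological spaces has [topologicalType] as objects and
   [continuousType X Y] as morphisms; the isomorphisms are the homeomorphisms. *)

Definition homeomorphism (X Y : topologicalType) (f : X -> Y) : Prop :=
  exists g : Y -> X, [/\ cancel f g, cancel g f, continuous f & continuous g].

(** * Coproducts and the one-point space *)

Section void_unit_topology.

Local Lemma everyT (T : Type) : (fun _ : set T => True) setT. Proof. by []. Qed.
Local Lemma everyI (T : Type) (A B : set T) : True -> True -> True. Proof. by []. Qed.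
Local Lemma everyU (T I : Type) (f : I -> set T) : (I -> True) -> True.
Proof. by []. Qed.

HB.instance Definition _ := @isOpenTopological.Build void
  (fun=> True) (@everyT void) (@everyI void) (@everyU void).
HB.instance Definition _ := @isOpenTopological.Build unit
  (fun=> True) (@everyT unit) (@everyI unit) (@everyU unit).

End void_unit_topology.

Section sum_topology.
Context {X Y : topologicalType}.

Definition sum_open (U : set (X + Y)) : Prop :=
  open (inl @^-1` U) /\ open (inr @^-1` U).

Local Lemma sum_openT : sum_open setT.
Proof. by split; exact: openT. Qed.

Local Lemma sum_openI (A B : set (X + Y)) :
  sum_open A -> sum_open B -> sum_open (A `&` B).
Proof. by move=> [? ?] [? ?]; split; exact: openI. Qed.

Local Lemma sum_openU (I : Type) (f : I -> set (X + Y)) :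
  (forall i, sum_open (f i)) -> sum_open (\bigcup_i f i).
Proof. by move=> fo; split; apply: bigcup_open => i _; case: (fo i). Qed.

HB.instance Definition _ := isOpenTopological.Build (X + Y)%type
  sum_openT sum_openI sum_openU.

Local Lemma inl_cts : continuous (@inl X Y).
Proof. by apply/continuousP => A []. Qed.
HB.instance Definition _ := isContinuous.Build X (X + Y)%type (@inl X Y) inl_cts.

Local Lemma inr_cts : continuous (@inr X Y).
Proof. by apply/continuousP => A []. Qed.
HB.instance Definition _ := isContinuous.Build Y (X + Y)%type (@inr X Y) inr_cts.

End sum_topology.

Section copair.
Context {X Y Z : topologicalType}.
Variables (f : continuousType X Z) (g : continuousType Y Z).

Definition copair (u : X + Y) : Z :=
  match u with inl x => f x | inr y => g y end.

Local Lemma copair_cts : continuous copair.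
Proof.
apply/continuousP => A oA; split.
- by move/continuousP: (@cts_fun _ _ f); apply.
- by move/continuousP: (@cts_fun _ _ g); apply.
Qed.
HB.instance Definition _ := isContinuous.Build (X + Y)%type Z copair copair_cts.

End copair.

Section initial_map.
Context {X : topologicalType}.

Definition from_void (u : void) : X := match u with end.

Local Lemma from_void_cts : continuous from_void.
Proof. by case. Qed.
HB.instance Definition _ := isContinuous.Build void X from_void from_void_cts.

End initial_map.

Section existT_map.
Context {I : choiceType} {X : I -> topologicalType} (i : I).

HB.instance Definition _ :=
  isContinuous.Build (X i) {i : I & X i} (existT X i) (existT_continuous i).

End existT_map.

Section sigT_copair.
Context {I : choiceType} {X : I -> topologicalType} {Z : topologicalType}.
Variable f : forall i, continuousType (X i) Z.

Definition sigT_copair (u : {i : I & X i}) : Z := f (tag u) (tagged u).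

Local Lemma sigT_copair_cts : continuous sigT_copair.
Proof. by case=> i x U nU; exact: (@cts_fun _ _ (f i) x U). Qed.
HB.instance Definition _ :=
  isContinuous.Build {i : I & X i} Z sigT_copair sigT_copair_cts.

End sigT_copair.

(* the structure maps of the symmetric monoidal category (Top, +, void) *)
Section cocartesian.
Context {X Y Z : topologicalType}.

Definition sum_swap : continuousType (X + Y)%type (Y + X)%type :=
  copair inr inl.

Definition sum_assoc :
    continuousType ((X + Y) + Z)%type (X + (Y + Z))%type :=
  copair (copair inl (inr \o inl)) (inr \o inr).

Definition sum_lunit : continuousType (void + X)%type X :=
  copair from_void idfun.

Definition sum_runit : continuousType (X + void)%type X :=
  copair idfun from_void.

End cocartesian.

Definition sum_map (X X' Y Y' : topologicalType)
    (f : continuousType X X') (g : continuousType Y Y') :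
    continuousType (X + Y)%type (X' + Y')%type :=
  copair (inl \o f) (inr \o g).

(** * Strong symmetric monoidal functors (Top, +) -> (Top, x) *)

Record monoidal_data := MonoidalData {
  ob :> topologicalType -> topologicalType;
  mor : forall X Y : topologicalType, continuousType X Y -> ob X -> ob Y;
  mu0 : unit -> ob void;
  mu : forall X Y : topologicalType, ob X * ob Y -> ob (X + Y)%type }.

Arguments mor E {X Y} f : rename.
Arguments mu0 E : rename.
Arguments mu E {X Y} : rename.

Record strong_symmetric_monoidal (E : monoidal_data) : Prop := {
  mor_continuous : forall (X Y : topologicalType) (f : continuousType X Y),
    continuous (mor E f);
  mor_id : forall (X : topologicalType) (x : E X),
    mor E (idfun : continuousType X X) x = x;
  mor_comp : forall (X Y Z : topologicalType)
      (f : continuousType X Y) (g : continuousType Y Z) (x : E X),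
    mor E (g \o f : continuousType X Z) x = mor E g (mor E f x);
  mu0_homeomorphism : homeomorphism (mu0 E);
  mu_homeomorphism : forall X Y : topologicalType,
    homeomorphism (@mu E X Y);
  mu_natural : forall (X X' Y Y' : topologicalType)
      (f : continuousType X X') (g : continuousType Y Y') (x : E X) (y : E Y),
    mor E (sum_map f g) (mu E (x, y)) = mu E (mor E f x, mor E g y);
  mu_assoc : forall (X Y Z : topologicalType) (x : E X) (y : E Y) (z : E Z),
    mor E sum_assoc (mu E (mu E (x, y), z)) = mu E (x, mu E (y, z));
  mu_lunit : forall (X : topologicalType) (x : E X),
    mor E sum_lunit (mu E (mu0 E tt, x)) = x;
  mu_runit : forall (X : topologicalType) (x : E X),
    mor E sum_runit (mu E (x, mu0 E tt)) = x;
  mu_swap : forall (X Y : topologicalType) (x : E X) (y : E Y),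
    mor E sum_swap (mu E (x, y)) = mu E (y, x) }.

(** * The finite product of a family of pointed spaces *)

Section finite_product.
Context {I : choiceType} (X : I -> topologicalType) (pt : forall i, X i).

Definition subprod (J : {fset I}) : topologicalType :=
  prod_topology (fun j : J => X (val j)).

(* the transition map, which is meant for [J `<=` K] *)
Definition subprod_ext (J K : {fset I}) (x : subprod J) : subprod K :=
  fun k => match @idP (val k \in J) with
           | ReflectT kJ => x [` kJ]%fset
           | ReflectF _ => pt (val k)
           end.
Arguments subprod_ext {J} K x.

(* The colimit over the finite subsets of [I] is the quotient of the disjoint
   union by the equivalence relation that the transition maps generate. *)
Definition finprod_step (a b : {J : {fset I} & subprod J}) : Prop :=
  (tag a `<=` tag b)%fset /\ tagged b = subprod_ext (tag b) (tagged a).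

Definition finprod_relb (a b : {J : {fset I} & subprod J}) : bool :=
  `[< clos_refl_sym_trans _ finprod_step a b >].

Local Lemma finprod_relb_refl : reflexive finprod_relb.
Proof. by move=> a; apply/asboolP; exact: rst_refl. Qed.

Local Lemma finprod_relb_sym : symmetric finprod_relb.
Proof. by move=> a b; apply/asboolP/asboolP; exact: rst_sym. Qed.

Local Lemma finprod_relb_trans : transitive finprod_relb.
Proof.
by move=> b a c /asboolP ab /asboolP bc; apply/asboolP; exact: rst_trans bc.
Qed.

Definition finprod_rel :=
  EquivRel finprod_relb finprod_relb_refl finprod_relb_sym finprod_relb_trans.

Definition finprod : topologicalType :=
  quotient_topology {eq_quot finprod_rel}.

Definition finprod_in (J : {fset I}) (x : subprod J) : finprod :=
  \pi_{eq_quot finprod_rel} (existT subprod J x).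

End finite_product.

Arguments subprod_ext {I X} pt {J} K x.

(** * Exponential functors *)

Section canonical_map.
Variable E : monoidal_data.

Definition basepoint (X : topologicalType) : E X := mor E from_void (mu0 E tt).

Section iterated.
Context {J : choiceType} (Y : J -> topologicalType).

Fixpoint iter_sum (s : seq J) : topologicalType :=
  match s with
  | [::] => void
  | j :: s' => (Y j + iter_sum s')%type
  end.

Fixpoint iter_mu (s : seq J) (e : forall j, E (Y j)) : E (iter_sum s) :=
  match s with
  | [::] => mu0 E tt
  | j :: s' => mu E (e j, iter_mu s' e)
  end.

Fixpoint iter_sum_map (s : seq J) :
    continuousType (iter_sum s) {j : J & Y j} :=
  match s with
  | [::] => from_void
  | j :: s' => copair (existT Y j) (iter_sum_map s')
  end.

End iterated.

(* By the symmetry axioms the enumeration of [J] is immaterial. *)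
Definition fin_mu (J : finType) (Y : J -> topologicalType)
    (e : prod_topology (fun j => E (Y j))) : E {j : J & Y j} :=
  mor E (iter_sum_map Y (enum J)) (iter_mu (enum J) e).

Context {I : choiceType} (X : I -> topologicalType).

Definition sub_coprod (J : {fset I}) :
    continuousType {j : J & X (val j)} {i : I & X i} :=
  sigT_copair (fun j : J =>
    existT X (val j) : continuousType (X (val j)) {i : I & X i}).

Definition canonical_on (J : {fset I})
    (e : subprod (fun i => E (X i)) J) : E {i : I & X i} :=
  mor E (sub_coprod J) (@fin_mu J (fun j => X (val j)) e).

(* The maps [finprod_in] are jointly surjective, so that the map [c] below is
   unique. *)
Definition induced_map
    (c : finprod (fun i => basepoint (X i)) -> E {i : I & X i}) : Prop :=
  forall (J : {fset I}) (e : subprod (fun i => E (X i)) J),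
    c (finprod_in (fun i => basepoint (X i)) e) = canonical_on e.

End canonical_map.

Definition exponential_functor (E : monoidal_data) : Prop :=
  strong_symmetric_monoidal E /\
  forall (I : choiceType) (X : I -> topologicalType),
    exists c : finprod (fun i => basepoint E (X i)) -> E {i : I & X i},
      induced_map c /\ homeomorphism c.

(** * The minimal exponential *)

Definition min_exp (X : topologicalType) : Type := {fset X}.

Section min_exp.
Context {X : topologicalType}.

HB.instance Definition _ := Choice.on (min_exp X).

Definition Exp (U : set X) : set (min_exp X) :=
  [set S : {fset X} | [set` S] `<=` U].

HB.instance Definition _ :=
  isSubBaseTopological.Build (min_exp X) (@open X) Exp.

End min_exp.

Definition min_exp_map (X Y : topologicalType) (f : continuousType X Y)
    (S : min_exp X) : min_exp Y := [fset f x | x in (S : {fset X})]%fset.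

Definition min_exp_mu (X Y : topologicalType) (p : min_exp X * min_exp Y) :
    min_exp (X + Y)%type :=
  ([fset inl x | x in (p.1 : {fset X})] `|`
   [fset inr y | y in (p.2 : {fset Y})])%fset.

Definition minimal_exponential : monoidal_data :=
  @MonoidalData (fun X => min_exp X) min_exp_map
    (fun=> fset0 : {fset void}) min_exp_mu.

(* Main.v *)
From HB Require Import structures.
From mathcomp Require Import all_boot all_order finmap.
From mathcomp Require Import all_classical topology.
From Stdlib Require Import Relation_Operators.
Require Import Defs.

(* The sets Exp(V) are a subbase of the topology, and for an open injection i
   with closed image the preimage map T |-> i^-1(T) is continuous, because
   i^-1(T) lies in U iff T lies in i(U) together with the complement of the
   image.  This inverts Exp(X) x Exp(Y) -> Exp(X + Y).  For an infinite
   family, T |-> (T /\ X_j)_j, with j in the finite set J of indices that T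
   meets, inverts the canonical map.  It is continuous at T because the open
   neighbourhood Exp(\coprod_(j in J) X_j) of T contains no set that meets
   an X_i with i outside J; on it the same J serves, and the map is the
   composite of the slices with the inclusion into the colimit. *)

Set Implicit Arguments.
Unset Strict Implicit.
Unset Printing Implicit Defensive.

Local Open Scope classical_set_scope.
Local Open Scope quotient_scope.

Lemma pair_continuous (X Y Z : topologicalType) (f : Z -> X) (g : Z -> Y) :
  continuous f -> continuous g -> continuous (fun z => (f z, g z)).
Proof. by move=> cf cg z; exact: cvg_pair (cf z) (cg z). Qed.

(** * The subbase of sets [Exp U], and functoriality *)

Section min_exp_topology.
Context {X : topologicalType}.

Lemma open_Exp (U : set X) : open U -> open (Exp U).
Proof.
move=> oU; exists [set Exp U]; last by rewrite bigcup_set1.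
by move=> _ ->; exact: finI_from1.
Qed.

(** Every neighbourhood of [S] contains a finite intersection of subbasic sets around [S], and
    filters are closed under finite intersections. *)
Lemma min_exp_cvg (F : set_system (min_exp X)) (S : min_exp X) : Filter F ->
  (forall U : set X, open U -> Exp U S -> F (Exp U)) -> F --> S.
Proof.
move=> FF FE A /=; rewrite (@nbhsE (min_exp X)) => -[_ [[B sB <-]] [C BC CS]].
move=> sBA; rewrite nbhs_filterE; apply: (filterS sBA).
apply: (@filterS _ _ _ C).
  by move=> T CT; exists C.
have [D sD DC] := sB _ BC; rewrite -DC; apply: filter_bigI => U DU.
apply: FE; first by have := sD _ DU; rewrite inE.
by move: CS; rewrite -DC => /(_ _ DU).
Qed.

Lemma min_exp_continuous (Z : topologicalType) (h : Z -> min_exp X) :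
  (forall U : set X, open U -> open (h @^-1` Exp U)) -> continuous h.
Proof.
move=> hE z; apply: min_exp_cvg => U oU Uhz.
by apply: open_nbhs_nbhs; split => //; exact: hE.
Qed.

End min_exp_topology.

Section min_exp_functor.
Context {X Y : topologicalType}.

Lemma min_exp_mapP (f : continuousType X Y) (S : min_exp X) (y : Y) :
  reflect (exists2 x, x \in (S : {fset X}) & y = f x)
          (y \in (min_exp_map f S : {fset Y})).
Proof. exact: imfsetP. Qed.

(** $f(S)\subset U$ iff $S\subset f^{-1}(U)$. *)
Lemma min_exp_map_continuous (f : continuousType X Y) :
  continuous (min_exp_map f).
Proof.
apply: min_exp_continuous => U oU.
rewrite (_ : _ @^-1` _ = Exp (f @^-1` U)).
  by apply: open_Exp; move/continuousP: (@cts_fun _ _ f); apply.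
apply/seteqP; split=> S /= SU.
  by move=> x Sx; apply: SU; apply/min_exp_mapP; exists x.
by move=> _ /= /min_exp_mapP[x Sx ->]; exact: SU.
Qed.

End min_exp_functor.

(** * Preimages of finite sets along injections *)

Section min_exp_preimage.
Context {X Y : topologicalType}.

(* [fset_set] is junk when the preimage is infinite. *)
Definition min_exp_preimage (i : X -> Y) (T : min_exp Y) : min_exp X :=
  fset_set (i @^-1` [set` (T : {fset Y})]).

Lemma in_min_exp_preimage (i : X -> Y) (T : min_exp Y) (x : X) :
  injective i ->
  (x \in (min_exp_preimage i T : {fset X})) = (i x \in (T : {fset Y})).
Proof.
move=> inj_i; rewrite in_fset_set; first by apply/idP/idP; rewrite inE.
by apply: finite_preimage => // ? ? _ _; exact: inj_i.
Qed.

(** The set required to be open is the union of $i(U)$ and the complement of the image of [i]; its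
    [Exp] is the preimage of [Exp U]. *)
Lemma min_exp_preimage_continuous (i : X -> Y) : injective i ->
  (forall U : set X, open U -> open [set y | forall x, i x = y -> U x]) ->
  continuous (min_exp_preimage i).
Proof.
move=> inj_i oi; apply: min_exp_continuous => U oU.
rewrite (_ : _ @^-1` _ = Exp [set y | forall x, i x = y -> U x]).
  by apply: open_Exp; exact: oi.
apply/seteqP; split=> T /= TU.
  move=> y /= Ty x ixy; apply: TU => /=.
  by rewrite in_min_exp_preimage // ixy.
by move=> x /=; rewrite in_min_exp_preimage // => /TU; exact.
Qed.

End min_exp_preimage.

(** * The symmetric monoidal structure *)

Section min_exp_sum.
Context {X Y : topologicalType}.

Lemma inl_min_exp_mu (S : min_exp X) (T : min_exp Y) (x : X) :
  (inl x \in (min_exp_mu (S, T) : {fset X + Y})) = (x \in (S : {fset X})).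
Proof.
rewrite in_fsetU mem_imfset /=; last by move=> ? ? [].
by rewrite orb_idr // => /imfsetP[].
Qed.

Lemma inr_min_exp_mu (S : min_exp X) (T : min_exp Y) (y : Y) :
  (inr y \in (min_exp_mu (S, T) : {fset X + Y})) = (y \in (T : {fset Y})).
Proof.
rewrite in_fsetU orbC mem_imfset /=; last by move=> ? ? [].
by rewrite orb_idr // => /imfsetP[].
Qed.

Definition in_min_exp_mu := (inl_min_exp_mu, inr_min_exp_mu).

(** $S\sqcup T\subset U$ iff [S] and [T] lie in the traces of [U] on the two summands, so a product
    of two subbasic sets maps into [Exp U]. *)
Lemma min_exp_mu_continuous : continuous (@min_exp_mu X Y).
Proof.
case=> S T; apply: min_exp_cvg => U [oUl oUr] USTU.
exists (Exp (inl @^-1` U), Exp (inr @^-1` U)) => /=.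
  split; apply: open_nbhs_nbhs; split; try exact: open_Exp.
    by move=> x Sx; apply: USTU; rewrite /= inl_min_exp_mu.
  by move=> y Ty; apply: USTU; rewrite /= inr_min_exp_mu.
move=> [S' T'] /= [S'U T'U] [x|y] /=; rewrite in_min_exp_mu.
  exact: S'U.
exact: T'U.
Qed.

Lemma min_exp_mu_homeomorphism : homeomorphism (@min_exp_mu X Y).
Proof.
have injl : injective (@inl X Y) by move=> ? ? [].
have injr : injective (@inr X Y) by move=> ? ? [].
exists (fun V => (min_exp_preimage inl V, min_exp_preimage inr V)); split.
- move=> [S T]; congr pair; apply/fsetP => u;
  by rewrite in_min_exp_preimage // in_min_exp_mu.
- by move=> V; apply/fsetP => -[x|y]; rewrite in_min_exp_mu in_min_exp_preimage.
- exact: min_exp_mu_continuous.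
- have contl : continuous (min_exp_preimage (@inl X Y)).
    (* The set to be shown open is [U] on the left summand and everything on the right one, which
       misses the image of [inl]. *)
    apply: min_exp_preimage_continuous => // U oU; split.
      rewrite (_ : _ @^-1` _ = U) //; apply/seteqP.
    by split=> u /= => [|Uu v [->]//]; exact.
    by rewrite (_ : _ @^-1` _ = setT); [exact: openT|apply/seteqP; split].
  have contr : continuous (min_exp_preimage (@inr X Y)).
    apply: min_exp_preimage_continuous => // U oU; split.
      by rewrite (_ : _ @^-1` _ = setT); [exact: openT|apply/seteqP; split].
    rewrite (_ : _ @^-1` _ = U) //; apply/seteqP.
    by split=> u /= => [|Uu v [->]//]; exact.
  exact: pair_continuous.
Qed.

End min_exp_sum.

Lemma minimal_exponential_monoidal :
  strong_symmetric_monoidal minimal_exponential.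
Proof.
split.
- exact: @min_exp_map_continuous.
- move=> X S; apply/fsetP => x.
  by apply/min_exp_mapP/idP => [[? ? ->]|? ]//; exists x.
- move=> X Y Z f g S; apply/fsetP => z; apply/min_exp_mapP/min_exp_mapP.
    by move=> [x Sx ->]; exists (f x) => //; apply/min_exp_mapP; exists x.
  by move=> [_ /min_exp_mapP[x Sx ->] ->]; exists x.
(* The only finite subset of [void] is the empty one. *)
- exists (fun=> tt); split=> [[] //|S||].
  + by apply/fsetP; case.
  + exact: cst_continuous.
  + exact: cst_continuous.
- exact: @min_exp_mu_homeomorphism.
- move=> X X' Y Y' f g S T; apply/fsetP => -[u|u]; rewrite in_min_exp_mu.
    apply/min_exp_mapP/min_exp_mapP.
      by move=> [[x|y]]; rewrite in_min_exp_mu //= => Sx [->]; exists x.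
    by move=> [x Sx ->]; exists (inl x); rewrite ?in_min_exp_mu.
  apply/min_exp_mapP/min_exp_mapP.
    by move=> [[x|y]]; rewrite in_min_exp_mu //= => Ty [->]; exists y.
  by move=> [y Ty ->]; exists (inr y); rewrite ?in_min_exp_mu.
- move=> X Y Z S T V; apply/fsetP => -[x|[y|z]]; rewrite !in_min_exp_mu.
  + apply/min_exp_mapP/idP => [[[[x'|?]|?]]|Sx]; rewrite ?in_min_exp_mu //=.
      by move=> Sx' [->].
    by exists (inl (inl x)); rewrite ?in_min_exp_mu.
  + apply/min_exp_mapP/idP => [[[[?|y']|?]]|Ty]; rewrite ?in_min_exp_mu //=.
      by move=> Ty' [->].
    by exists (inl (inr y)); rewrite ?in_min_exp_mu.
  + apply/min_exp_mapP/idP => [[[[?|?]|z']]|Vz]; rewrite ?in_min_exp_mu //=.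
      by move=> Vz' [->].
    by exists (inr z); rewrite ?in_min_exp_mu.
- move=> X S; apply/fsetP => x; apply/min_exp_mapP/idP => [[[[]|x']]|Sx].
    by rewrite in_min_exp_mu => ? ->.
  by exists (inr x); rewrite ?in_min_exp_mu.
- move=> X S; apply/fsetP => x; apply/min_exp_mapP/idP => [[[x'|[]]]|Sx].
    by rewrite in_min_exp_mu => ? ->.
  by exists (inl x); rewrite ?in_min_exp_mu.
- move=> X Y S T; apply/fsetP => -[y|x]; rewrite in_min_exp_mu.
    apply/min_exp_mapP/idP => [[[?|y']]|Ty]; rewrite ?in_min_exp_mu //=.
      by move=> ? [->].
    by exists (inr y); rewrite ?in_min_exp_mu.
  apply/min_exp_mapP/idP => [[[x'|?]]|Sx]; rewrite ?in_min_exp_mu //=.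
    by move=> ? [->].
  by exists (inl x); rewrite ?in_min_exp_mu.
Qed.

(** * The canonical map at a finite stage *)

Section canonical_map.
Local Notation E := minimal_exponential.

(** Repetitions in [s] are harmless: copies of one summand are folded together and carry the same
    finite set. *)
Lemma in_iter_mu (J : choiceType) (Y : J -> topologicalType) (s : seq J)
    (e : forall j, E (Y j)) (p : {j : J & Y j}) :
  (p \in (mor E (iter_sum_map Y s) (iter_mu s e) : {fset {j : J & Y j}})) =
  (tag p \in s) && (tagged p \in (e (tag p) : {fset Y (tag p)})).
Proof.
elim: s => [|j s IHs]; first by apply/min_exp_mapP => -[].
apply/min_exp_mapP/andP => [[[y|v]]|].
- by rewrite in_min_exp_mu => ey ->; rewrite mem_head.
- rewrite in_min_exp_mu => sv pE; move: IHs.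
  have -> : p \in mor E (iter_sum_map Y s) (iter_mu s e).
    by apply/min_exp_mapP; exists v.
  by rewrite inE => /esym/andP[-> ->]; rewrite orbT.
- case=> + ep; rewrite inE; have [pj _|_ /= ps] := eqVneq (tag p) j.
    subst j; exists (inl (tagged p)); rewrite ?in_min_exp_mu //.
    by case: p {IHs} ep.
  have := IHs; rewrite ps ep => /min_exp_mapP[v sv ->].
  by exists (inr v); rewrite ?in_min_exp_mu.
Qed.

Lemma iter_mu_continuous (J : choiceType) (Y : J -> topologicalType)
    (s : seq J) :
  continuous (iter_mu s : prod_topology (fun j => E (Y j)) -> E (iter_sum Y s)).
Proof.
elim: s => [|j s IHs] e; first exact: cst_continuous.
have cont_j : continuous
    (fun e' : prod_topology (fun j => E (Y j)) => e' j).
  exact: (@proj_continuous _ (fun j => E (Y j)) j).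
have cont_pair := pair_continuous cont_j IHs.
exact: continuous_comp (cont_pair e) (@min_exp_mu_continuous _ _ _).
Qed.

Context {I : choiceType} (X : I -> topologicalType).
Local Notation EX := (fun i => E (X i)).
Local Notation pt := (fun i => basepoint E (X i)).

Lemma canonical_on_continuous (J : {fset I}) :
  continuous (@canonical_on E I X J).
Proof.
move=> e; apply: continuous_comp; last exact: min_exp_map_continuous.
apply: continuous_comp; last exact: min_exp_map_continuous.
exact: iter_mu_continuous.
Qed.

Lemma existT_inj (i : I) : injective (existT X i).
Proof.
by move=> x y /eqP; rewrite -tag_eqE /tag_eq eqxx tagged_asE => /eqP.
Qed.

(** With [tag_canonical_on] this identifies [canonical_on e] as the disjoint union of the [e j]; the
    enumeration of [J] drops out. *)
Lemma in_canonical_on (J : {fset I}) (e : subprod EX J) (j : J)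
    (x : X (val j)) :
  (existT X (val j) x \in (canonical_on e : {fset {i : I & X i}})) =
  (x \in (e j : {fset X (val j)})).
Proof.
apply/min_exp_mapP/idP => [[[j' x']]|ex].
  rewrite in_iter_mu => /andP[_ /= ex'] xE.
  have jj' : j = j' by apply: val_inj; exact: (congr1 tag xE).
  by subst j'; rewrite (existT_inj xE).
by exists (existT (fun k : J => X (val k)) j x); rewrite // in_iter_mu mem_enum.
Qed.

Lemma tag_canonical_on (J : {fset I}) (e : subprod EX J) (u : {i : I & X i}) :
  u \in (canonical_on e : {fset {i : I & X i}}) -> tag u \in J.
Proof.
by case/min_exp_mapP => -[j x] _ ->; exact: fsvalP.
Qed.

Lemma subprod_ext_in (J K : {fset I}) (e : subprod EX J) (k : K)
    (kJ : val k \in J) : subprod_ext pt K e k = e [` kJ]%fset.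
Proof.
(* The proof [idP] matched on in [subprod_ext] is generalised together with its boolean index, so
   that it can be destructed. *)
suff extE b (r : reflect (val k \in J) b) :
    match r with ReflectT h => e [` h]%fset | ReflectF _ => pt (val k) end =
    e [` kJ]%fset by exact: extE.
by case: r => [h|/(_ kJ)//]; rewrite (bool_irrelevance h kJ).
Qed.

Lemma subprod_ext_notin (J K : {fset I}) (e : subprod EX J) (k : K) :
  val k \notin J -> subprod_ext pt K e k = basepoint E (X (val k)).
Proof.
move=> kJ.
suff extE b (r : reflect (val k \in J) b) :
    match r with ReflectT h => e [` h]%fset | ReflectF _ => pt (val k) end =
    pt (val k) by exact: extE.
by case: r => // h; rewrite h in kJ.
Qed.

(** The base point is the image of the empty set, hence empty, so padding by base points adds no
    element. *)
Lemma canonical_on_ext (J K : {fset I}) (e : subprod EX J) : (J `<=` K)%fset ->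
  canonical_on (subprod_ext pt K e) = canonical_on e.
Proof.
move=> /fsubsetP JK; apply/fsetP => -[i x].
have [iK|iK] := boolP (i \in K); last first.
  by apply/idP/idP => [/tag_canonical_on|/tag_canonical_on/JK] /=;
    rewrite (negbTE iK).
rewrite (@in_canonical_on K _ [` iK]%fset).
have [iJ|iJ] := boolP (i \in J).
  by rewrite subprod_ext_in (@in_canonical_on J e [` iJ]%fset).
rewrite subprod_ext_notin //; apply/min_exp_mapP/idP => [[]//|].
by move/tag_canonical_on; rewrite /= (negbTE iJ).
Qed.

(** * Slices, and the inverse of the canonical map *)

Definition slices (J : {fset I}) (T : E {i : I & X i}) : subprod EX J :=
  fun j => min_exp_preimage (existT X (val j)) T.
Arguments slices : clear implicits.

Lemma existT_preimage_continuous (i : I) :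
  continuous (min_exp_preimage (existT X i)).
Proof.
apply: min_exp_preimage_continuous => [|U oU]; first exact: existT_inj.
apply/sigT_openP => k; have [<-|ik] := eqVneq i k.
  rewrite (_ : _ @^-1` _ = U) //.
  apply/seteqP; split=> x /= Ux; first exact: Ux.
  by move=> y /existT_inj ->.
rewrite (_ : _ @^-1` _ = setT); first exact: openT.
apply/seteqP; split=> // x _ y /= /(congr1 tag) /= jE.
by rewrite jE eqxx in ik.
Qed.

Lemma slices_continuous (J : {fset I}) : continuous (slices J).
Proof.
move=> T; have FT : Filter (slices J @ T) by exact/fmap_filter/nbhs_filter.
(* The product topology is the supremum of those induced by the projections, so coordinates
   suffice. *)
apply/cvg_sup => j A [_ [[B oB <-] BT]] /filterS; apply.
apply: (@existT_preimage_continuous (val j) T B).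
exact: open_nbhs_nbhs.
Qed.

Lemma slices_canonical_on (J : {fset I}) (e : subprod EX J) :
  slices J (canonical_on e) = e.
Proof.
apply: functional_extensionality_dep => j; apply/fsetP => x.
by rewrite in_min_exp_preimage ?in_canonical_on//; exact: existT_inj.
Qed.

Lemma canonical_on_slices (J : {fset I}) (T : E {i : I & X i}) :
  (forall u, u \in (T : {fset {i : I & X i}}) -> tag u \in J) ->
  canonical_on (slices J T) = T.
Proof.
move=> TJ; apply/fsetP => -[i x].
have [iJ|iJ] := boolP (i \in J).
  rewrite (@in_canonical_on J _ [` iJ]%fset) in_min_exp_preimage //.
  exact: existT_inj.
by apply/idP/idP => [/tag_canonical_on|/TJ] /=; rewrite (negbTE iJ).
Qed.

Definition tags (T : E {i : I & X i}) : {fset I} :=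
  [fset tag u | u in (T : {fset {i : I & X i}})]%fset.

Lemma mem_tags (T : E {i : I & X i}) (u : {i : I & X i}) :
  u \in (T : {fset {i : I & X i}}) -> tag u \in tags T.
Proof. by move=> Tu; apply/imfsetP; exists u. Qed.

Definition canonical_inv (T : E {i : I & X i}) : finprod pt :=
  finprod_in pt (slices (tags T) T).

Lemma finprod_in_ext (J K : {fset I}) (e : subprod EX J) : (J `<=` K)%fset ->
  finprod_in pt e = finprod_in pt (subprod_ext pt K e).
Proof. by move=> JK; apply/eqmodP/asboolP; apply: rst_step. Qed.

(** The stage [tags T] varies with [T]; this replaces it by any larger one, which can be kept fixed
    on a neighbourhood. *)
Lemma canonical_inv_slices (J : {fset I}) (T : E {i : I & X i}) :
  (tags T `<=` J)%fset -> canonical_inv T = finprod_in pt (slices J T).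
Proof.
move=> TJ; rewrite /canonical_inv (finprod_in_ext _ TJ); congr finprod_in.
(* Since [slices J] is a left inverse of [canonical_on], the padded family is recovered from its
   image, which is [T]. *)
rewrite -(slices_canonical_on (subprod_ext _ _ _)) canonical_on_ext//.
by rewrite canonical_on_slices//; exact: mem_tags.
Qed.

(** * The canonical map on the colimit, and continuity both ways *)

Definition canonical_map (q : finprod pt) : E {i : I & X i} :=
  canonical_on (tagged (repr q)).

Lemma canonical_map_induced : induced_map canonical_map.
Proof.
move=> J e; rewrite /canonical_map /finprod_in; case: piP => a.
(* The pair of [J] and [e] is made explicit for an induction on the generated equivalence; only a
   transition step needs an argument. *)
rewrite -[canonical_on e]/(canonical_on (tagged (existT (subprod EX) J e))).
move=> /eqmodP/asboolP; move: (existT _ J e) => b.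
elim=> {a b} [a b [ab ->]|//|a b _ -> //|a b c _ <- _ <- //].
by rewrite canonical_on_ext.
Qed.

Lemma canonical_inv_continuous : continuous canonical_inv.
Proof.
move=> T; set J := tags T.
(* A union of summands is open in the coproduct, and [T] lies over [J] by the choice of [J]. *)
have nT : nbhs T (Exp [set u : {i : I & X i} | tag u \in J]).
  apply: open_nbhs_nbhs; split; last by move=> u /=; exact: mem_tags.
  apply/open_Exp/sigT_openP => i.
  have [iJ|iJ] := boolP (i \in J).
    by rewrite (_ : _ @^-1` _ = setT); [exact: openT|apply/seteqP; split].
  rewrite (_ : _ @^-1` _ = set0); first exact: open0.
  apply/seteqP; split=> // x /=.
  by rewrite (negbTE iJ).
have invE T' : Exp [set u : {i : I & X i} | tag u \in J] T' ->
    canonical_inv T' = finprod_in pt (slices J T').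
  move=> T'J; apply: canonical_inv_slices.
  by apply/fsubsetP => _ /imfsetP[u /= T'u ->]; exact: T'J.
have cont : continuous (fun T' => finprod_in pt (slices J T')).
  move=> T'; apply: continuous_comp; first exact: slices_continuous.
  apply: continuous_comp; first exact: existT_continuous.
  exact: pi_continuous.
move=> A; rewrite invE; last exact: nbhs_singleton nT.
move=> /cont; apply: filterS2 nT => T' T'J /=.
by rewrite invE.
Qed.

Lemma canonical_map_continuous : continuous canonical_map.
Proof.
(* Continuity is tested on the disjoint union of the stages, where the map is [canonical_on] on each
   stage. *)
apply/quotient_continuous.
have -> : canonical_map \o \pi = fun a => canonical_on (tagged a).
  by apply/funext => -[J e]; exact: canonical_map_induced.
by case=> J e A nA; exact: (@canonical_on_continuous J e A nA).
Qed.

End canonical_map.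

Theorem proposition2p20 : exponential_functor minimal_exponential.
Proof.
split=> [|I X]; first exact: minimal_exponential_monoidal.
exists (@canonical_map I X); split; first exact: canonical_map_induced.
exists (@canonical_inv I X); split.
- move=> q; rewrite -[q]reprK; case: (repr q) => J e.
  rewrite -[\pi _]/(finprod_in _ e) canonical_map_induced.
  (* Components of [e] may be empty, so the tags of its image can form a proper subset of [J]. *)
  rewrite (@canonical_inv_slices _ _ J) ?slices_canonical_on//.
  by apply/fsubsetP => _ /imfsetP[u /tag_canonical_on uJ ->].
- move=> T; rewrite canonical_map_induced canonical_on_slices//.
  exact: mem_tags.
- exact: canonical_map_continuous.
- exact: canonical_inv_continuous.
Qed.
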